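(* Let $F$ be a compact subset of $\mathbb{R}^n$, let $0< \theta \leq 1$, and suppose $0< s< \underline{\dim}_{\theta} F$. There exists a constant $c >0$ such that for all $\delta \in (0,1)$ there is a Borel probability measure $\mu_\delta$ supported on $F$ such that for all $x \in \mathbb{R}^n$ and $\delta^{1/\theta} \leq r \leq \delta$, $$\mu_\delta (B(x,r)) \leq c r^s .$$ Moreover, $\mu_\delta$ can be taken to be a finite collection of atoms.
   Context: $B(x,r)$ denotes the ball of centre $x$ and radius $r$. For a set $U\subseteq\mathbb{R}^n$, $|U|$ denotes its diameter. A cover $\{U_i\}$ of $F$ is a finite or countable collection of sets with $F\subseteq\bigcup_i U_i$. For bounded $F\subseteq\mathbb{R}^n$ and $0<\theta\leq 1$, the lower $\theta$-intermediate dimension $\underline{\dim}_{\theta} F$ is the infimum of all $s\geq 0$ such that for all $\epsilon>0$ and all $\delta_0>0$ there exist $0<\delta\leq\delta_0$ and a cover $\{U_i\}$ of $F$ with $\delta^{1/\theta}\leq |U_i|\leq\delta$ for all $i$ and $\sum_i |U_i|^s\leq\epsilon$. ''A finite collection of atoms'' means a finite sum of weighted point masses. *)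

(* Defs.v *)
From HB Require Import structures.
From mathcomp Require Import all_boot all_order all_algebra.
From mathcomp Require Import all_classical all_reals all_analysis.

Set Implicit Arguments.
Unset Strict Implicit.
Unset Printing Implicit Defensive.

Import Order.TTheory GRing.Theory Num.Theory.
Import numFieldNormedType.Exports.

Local Open Scope classical_set_scope.
Local Open Scope ring_scope.

(* The canonical norm on 'rV[R]_n is the sup norm, so diameters and balls are
   defined here from the Euclidean distance. Topological notions (compact,
   open, Borel) use the canonical topology, which is the same for both norms. *)
Definition edist (R : realType) (n : nat) (x y : 'rV[R]_n) : R :=
  Num.sqrt (\sum_(i < n) (x ord0 i - y ord0 i) ^+ 2).

Definition eball (R : realType) (n : nat) (x : 'rV[R]_n) (r : R) :
    set 'rV[R]_n :=
  [set y | edist x y <= r].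

(* The maximum with 0 gives the empty set diameter 0 instead of -oo. *)
Definition diam (R : realType) (n : nat) (U : set 'rV[R]_n) : \bar R :=
  maxe 0%E (ereal_sup [set d | exists x y, [/\ U x, U y & d = (edist x y)%:E]]).

(* A finite or countable cover is a family indexed by a set J of naturals. *)
Definition theta_cover (R : realType) (n : nat) (theta delta : R)
    (F : set 'rV[R]_n) (J : set nat) (U : nat -> set 'rV[R]_n) : Prop :=
  F `<=` \bigcup_(i in J) U i /\
  forall i, J i -> ((delta `^ theta^-1)%:E <= diam (U i) <= delta%:E)%E.

Definition theta_admissible (R : realType) (n : nat) (theta : R)
    (F : set 'rV[R]_n) (s : R) : Prop :=
  forall eps delta0 : R, 0 < eps -> 0 < delta0 ->
  exists delta : R, 0 < delta <= delta0 /\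
  exists (J : set nat) (U : nat -> set 'rV[R]_n),
    theta_cover theta delta F J U /\
    (\esum_(i in J) (diam (U i) `^ s) <= eps%:E)%E.

(* For 0 < n and F bounded the set below contains every s > n, so the infimum
   is a genuine one. For n = 0 and F a point the set is empty and the
   convention inf set0 = 0 gives the value 0. *)
Definition lower_theta_dim (R : realType) (n : nat) (theta : R)
    (F : set 'rV[R]_n) : R :=
  inf [set s : R | 0 <= s /\ theta_admissible theta F s].

Definition borelRn (R : realType) (n : nat) :=
  g_sigma_algebraType (@open 'rV[R]_n).

Definition supported_on (R : realType) (n : nat)
    (mu : probability (borelRn R n) R) (F : set 'rV[R]_n) : Prop :=
  mu (~` F) = 0%E.

Definition finitely_atomic (R : realType) (n : nat)
    (mu : probability (borelRn R n) R) : Prop :=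
  exists (k : nat) (w : 'I_k -> R) (a : 'I_k -> borelRn R n),
    (forall i, 0 <= w i) /\
    forall A : set (borelRn R n), measurable A ->
      mu A = (\sum_(i < k) (w i)%:E * \d_(a i) A)%E.

(* Main.v *)
(* A finite net P of F at scale rho = delta^(1/theta) is weighted greedily: its
   points are visited in turn, each receiving as much mass as the constraints
   [w(ball) <= radius^s] over balls centred in P with radius in
   [rho, 2 delta] allow. At the end every point lies in a saturated ball. A
   Vitali selection of disjoint saturated balls bounds the total mass below by
   the sum of radius^s over a family whose enlargements cover F; these
   enlargements form an admissible cover at scale K delta, so this sum is
   bounded below because s is less than the lower theta-intermediate dimension.
   Normalising w gives the measure. Balls are taken in the sup norm, which
   costs only constants depending on n. *)
Require Import Defs.
From HB Require Import structures.
From mathcomp Require Import all_boot all_order all_algebra.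
From mathcomp Require Import all_classical all_reals all_analysis.
From mathcomp Require Import ring lra.
Import Order.TTheory GRing.Theory Num.Theory.
Import numFieldNormedType.Exports.
Local Open Scope classical_set_scope.
Local Open Scope ring_scope.

(** * Finite combinatorics of constraints and disjoint selections *)

Lemma greedy_weights (R : realDomainType) (P J : finType)
    (B : J -> {set P}) (c : J -> R) (cover : forall p, exists j, p \in B j)
    (c_ge0 : forall j, 0 <= c j) :
  exists w : P -> R, [/\ forall p, 0 <= w p,
    forall j, \sum_(p in B j) w p <= c j &
    forall p, exists2 j, p \in B j & \sum_(q in B j) w q = c j].
Proof.
suff [w [w_ge0 w_le w_sat]] : exists w : P -> R, [/\ forall p, 0 <= w p,
    forall j, \sum_(p in B j) w p <= c j &
    forall p, p \in enum P ->
      exists2 j, p \in B j & \sum_(q in B j) w q = c j].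
  by exists w; split=> // p; apply: w_sat; rewrite mem_enum.
elim: (enum P) => [|p s [w [w_ge0 w_le w_sat]]].
  by exists (fun=> 0); split=> // j; rewrite big1.
have [j0 pj0] := cover p.
pose slack j := c j - \sum_(q in B j) w q.
have [j pj slack_min] := @Order.TotalTheory.arg_minP _ _ _ j0
  (fun j => p \in B j) slack pj0.
have slack_ge0 : 0 <= slack j by rewrite subr_ge0.
(* Giving [p] the least slack among the constraints containing it violates none of them and makes
   the minimiser [j] tight. *)
pose w' q := w q + slack j *+ (q == p).
have w'E k : \sum_(q in B k) w' q =
    \sum_(q in B k) w q + slack j *+ (p \in B k).
  rewrite big_split /=; congr (_ + _); case: (boolP (p \in B k)) => pk.
    rewrite (bigD1 p) //= eqxx big1 ?addr0 // => q /andP[_ /negPf ->].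
    by rewrite mulr0n.
  rewrite big1 // => q qk; case: eqP => // qp.
  by rewrite -qp qk in pk.
have w'_le k : \sum_(q in B k) w' q <= c k.
  rewrite w'E; case: (boolP (p \in B k)) => pk; last by rewrite addr0.
  by rewrite -lerBrDl mulr1n; exact: (slack_min k pk).
exists w'; split=> // q; first by rewrite addr_ge0 // mulrn_wge0.
rewrite inE => /predU1P[->|qs].
  by exists j => //; rewrite w'E pj /slack addrC subrK.
(* Tight constraints stay tight: weights never decrease, and [w'_le] caps the sum. *)
have [k qk sk] := w_sat q qs; exists k => //; apply/le_anti.
by rewrite w'_le w'E sk lerDl mulrn_wge0.
Qed.

(** Take an element of largest [rad], discard everything it meets, and recurse on the rest: whatever
    is discarded meets a chosen element at least as large. *)
Lemma finite_vitali (R : realDomainType) (J : finType) (meets : rel J)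
    (rad : J -> R) (A : {set J}) (meets_refl : reflexive meets)
    (meets_sym : symmetric meets) :
  exists D : {set J}, [/\ D \subset A,
    {in D &, forall i j, meets i j -> i = j} &
    {in A, forall i, exists2 j, j \in D & meets i j && (rad i <= rad j)}].
Proof.
have [m] := ubnP #|A|; elim: m A => // m IH A /ltnSE leAm.
have [->|[i0 i0A]] := set_0Vmem A.
  by exists finset.set0; split => [|i j|i]; rewrite ?finset.sub0set ?inE.
have [i iA i_max] := @Order.TotalTheory.arg_maxP _ _ _ i0
  (fun i => i \in A) rad i0A.
pose A' := [set j in A | ~~ meets i j]%SET.
have A'A : A' \subset A by apply/fintype.subsetP => j; rewrite inE => /andP[].
have [|D [DA' D_disj D_cov]] := IH A'.
  apply: leq_trans leAm; apply: proper_card; apply/properP; split => //.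
  by exists i => //; rewrite inE meets_refl andbF.
have D_i j : j \in D -> ~~ meets i j.
  by move=> /(fintype.subsetP DA'); rewrite inE => /andP[].
exists (i |: D)%SET; split.
- by rewrite finset.subUset finset.sub1set iA (fintype.subset_trans DA').
- move=> j k /finset.setU1P[->|jD] /finset.setU1P[->|kD] //.
  + by rewrite (negPf (D_i _ kD)).
  + by rewrite meets_sym (negPf (D_i _ jD)).
  + exact: D_disj.
- move=> j jA; have [ij|nij] := boolP (meets i j).
    by exists i; rewrite ?finset.setU11 // meets_sym ij /=; exact: i_max.
  have [|k kD jk] := D_cov j; first by rewrite inE jA.
  by exists k; rewrite // finset.setU1r.
Qed.

(** * Nets and cubes in the sup norm *)

Lemma finite_net (R : realType) (n : nat) (F : set 'rV[R]_n) (rho : R)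
    (hF : compact F) (rho0 : 0 < rho) :
  exists s : seq 'rV[R]_n, (forall x, x \in s -> F x) /\
    forall x, F x -> exists2 y, y \in s & `|x - y| <= rho.
Proof.
move: hF; rewrite compact_cover => /(_ _ F (fun y => ball y rho)) [].
- by move=> y _; exact: ball_open.
- by move=> x Fx; exists x => //; exact: ballxx.
- move=> D DF Dcov; exists (finmap.enum_fset D); split.
    by move=> x xD; have := DF x xD; rewrite inE.
  move=> x /Dcov [y yD]; rewrite -ball_normE /= => xy; exists y => //.
  by rewrite distrC ltW.
Qed.

Lemma normr_rV_leP (R : realType) (n : nat) (x : 'rV[R]_n) (h : R) :
  0 <= h -> `|x| <= h <-> forall i, `|x ord0 i| <= h.
Proof.
move=> h0; rewrite [`|x|]mx_normrE; split.
  by move=> /bigmax_leP[_ xh] i; exact: (xh (ord0, i)).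
by move=> xh; apply/bigmax_leP; split => // -[i j] _ /=; rewrite (ord1 i).
Qed.

Lemma normr_le_edist (R : realType) (n : nat) (x y : 'rV[R]_n) :
  `|x - y| <= Defs.edist x y.
Proof.
apply/normr_rV_leP; first exact: sqrtr_ge0.
move=> i; rewrite -sqrtr_sqr; apply: ler_wsqrtr.
by rewrite (bigD1 i) //= !mxE lerDl sumr_ge0 // => j _; exact: sqr_ge0.
Qed.

(** Coordinatewise bounds give the upper estimate and two opposite corners attain it. The exact
    value is wanted because covering sets have diameters bounded on both sides. *)
Lemma diam_cube (R : realType) (n : nat) (x : 'rV[R]_n.+1) (h : R) :
  0 <= h ->
  diam [set y | `|x - y| <= h] = (Num.sqrt n.+1%:R * (2 * h))%:E.
Proof.
move=> h0.
have d0 : 0 <= Num.sqrt n.+1%:R * (2 * h).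
  by rewrite mulr_ge0 ?sqrtr_ge0 // mulr_ge0.
apply/le_anti/andP; split.
  rewrite /diam ge_max lee_fin d0 /=.
  apply: ge_ereal_sup => _ [y [z [hy hz ->]]].
  rewrite lee_fin -[2 * h]ger0_norm ?mulr_ge0 // -sqrtr_sqr -sqrtrM //.
  apply: ler_wsqrtr; rewrite mulr_natl.
  have -> : (2 * h) ^+ 2 *+ n.+1 = \sum_(i < n.+1) (2 * h) ^+ 2.
    by rewrite sumr_const card_ord.
  apply: ler_sum => i _; rewrite -real_normK ?num_real //.
  rewrite lerXn2r ?nnegrE ?mulr_ge0 //.
  move: hy => /= /(normr_rV_leP _ _ _ _ h0)/(_ i) hy.
  move: hz => /= /(normr_rV_leP _ _ _ _ h0)/(_ i) hz.
  rewrite !mxE in hy hz.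
  rewrite mulr_natl mulr2n.
  have -> : y ord0 i - z ord0 i = (x ord0 i - z ord0 i) - (x ord0 i - y ord0 i).
    by rewrite [RHS]addrC opprB addrA subrK.
  by apply: le_trans (ler_normB _ _) _; rewrite lerD.
rewrite /diam le_max; apply/orP; right; apply: ereal_sup_ubound.
exists (x - const_mx h), (x + const_mx h); split => /=.
- by apply/normr_rV_leP => // i; rewrite !mxE opprB addrC subrK ger0_norm.
- apply/normr_rV_leP => // i.
  by rewrite !mxE opprD addrA subrr sub0r normrN ger0_norm.
- rewrite /Defs.edist; congr (_%:E).
  under eq_bigr do rewrite !mxE.
  rewrite (eq_bigr (fun=> (2 * h) ^+ 2)) => [|i _].
    rewrite sumr_const card_ord -[X in _ = Num.sqrt X]mulr_natl sqrtrM //.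
    rewrite sqrtr_sqr ger0_norm //.
    by rewrite mulr_ge0.
  rewrite -sqrrN; congr (_ ^+ 2).
  by ring.
Qed.

(** * Atomic weights and the cover they control *)

Lemma atomic_probability (R : realType) (d : measure_display)
    (T : measurableType d) (k : nat) (w : 'I_k -> R) (a : 'I_k -> T)
    (w_ge0 : forall i, 0 <= w i) (w_sum : \sum_i w i = 1) :
  exists mu : probability T R,
    forall A, mu A = (\sum_(i < k) (w i)%:E * \d_(a i) A)%E.
Proof.
(* [msum] takes a family indexed by all naturals, so indices from [k] on are padded with the zero
   measure. *)
pose m (j : nat) : {measure set T -> \bar R} :=
  if insub j is Some i then mscale (NngNum (w_ge0 i)) \d_(a i) else mzero.
have mE A : msum m k A = (\sum_(i < k) (w i)%:E * \d_(a i) A)%E.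
  by apply: eq_bigr => i _; rewrite /m valK.
have m1 : msum m k setT = 1%E.
  rewrite mE; under eq_bigr do rewrite diracT mule1.
  by rewrite sumEFin w_sum.
pose isP := Measure_isProbability.Build _ _ _ (msum m k) m1.
pose mu : probability T R := HB.pack (msum m k) isP.
by exists mu.
Qed.

(** After exchanging the sums, each point is counted at most once. *)
Lemma sum_disjoint_le (R : realDomainType) (P J : finType) (B : J -> {set P})
    (D : {set J}) (w : P -> R) (w_ge0 : forall p, 0 <= w p)
    (D_disj : {in D &, forall i j p, p \in B i -> p \in B j -> i = j}) :
  \sum_(j in D) \sum_(p in B j) w p <= \sum_p w p.
Proof.
rewrite (exchange_big_dep xpredT) //=; apply: ler_sum => p _.
have [j /andP[jD pj]|none] := pickP (fun j => (j \in D) && (p \in B j));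
  last by rewrite big1 // => j; rewrite none.
rewrite (big_pred1 j) // => i /=; apply/andP/eqP => [[iD pi]|-> //].
exact: (D_disj _ _ iD jD p).
Qed.

(** Balls with arbitrary centres are compared with balls of at most twice the radius about net
    points, hence [2 * r] and radii up to [2 * delta]. *)
Lemma frostman_weights (R : realType) (n : nat) (F : set 'rV[R]_n)
    (rho delta s : R) (hF : compact F) (rho0 : 0 < rho)
    (rho_delta : rho <= delta) (s0 : 0 <= s) :
  exists (k : nat) (a : 'I_k -> 'rV[R]_n) (w : 'I_k -> R)
    (D : seq ('rV[R]_n * R)),
  [/\ forall i, F (a i), forall i, 0 <= w i,
      forall x r, rho <= r <= delta ->
        \sum_(i | `|x - a i| <= r) w i <= (2 * r) `^ s,
      forall d, d \in D -> rho <= d.2 <= 2 * delta &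
      (forall x, F x -> exists2 d, d \in D & `|d.1 - x| <= 4 * d.2) /\
      \sum_(d <- D) d.2 `^ s <= \sum_i w i].
Proof.
have [net [netF net_dense]] := finite_net R n F rho hF rho0.
pose k := size net; pose a (i : 'I_k) := nth 0 net i.
(* A ball of radius r >= rho centred at [a p] meets the net in a subset of the
   ball of radius [rad (p, q) <= r], q being the farthest index in it, so
   finitely many constraints suffice. *)
pose rad (j : 'I_k * 'I_k) := Num.max rho `|a j.1 - a j.2|.
(* A radius above [2 * delta] gives an empty set, so that its constraint holds trivially. *)
pose B (j : 'I_k * 'I_k) :=
  [set q : 'I_k | (rad j <= 2 * delta) && (`|a j.1 - a q| <= rad j)]%SET.
have rad_rho p : rad (p, p) = rho by rewrite /rad subrr normr0 max_l ?ltW.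
have rho_rad j : rho <= rad j by rewrite le_max lexx.
have rho_2delta : rho <= 2 * delta by lra.
have B_refl p : exists j, p \in B j.
  by exists (p, p); rewrite inE rad_rho /= subrr normr0 rho_2delta ltW.
have [w [w_ge0 w_le w_sat]] :=
  greedy_weights R _ _ B (fun j => rad j `^ s) B_refl (fun j => powR_ge0 _ _).
pose A := [set j | (rad j <= 2 * delta) &&
  (\sum_(q in B j) w q == rad j `^ s)]%SET.
(* Equality is included because [B j] may be empty, while [finite_vitali] asks for reflexivity. *)
pose meets i j := (i == j) || [exists q, (q \in B i) && (q \in B j)].
have meets_refl : reflexive meets by move=> i; rewrite /meets eqxx.
have meets_sym : symmetric meets.
  move=> i j; rewrite /meets eq_sym; congr (_ || _).
  by apply: eq_existsb => q; rewrite andbC.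
have [D [DA D_disj D_cov]] :=
  finite_vitali R _ meets rad A meets_refl meets_sym.
exists k, a, w, [seq (a j.1, rad j) | j in D]; split => //.
- by move=> i; apply: netF; exact: mem_nth.
- move=> x r /andP[rho_r r_delta].
  have [p xp|none] := pickP (fun i => `|x - a i| <= r); last first.
    by rewrite big1 ?powR_ge0 // => i; rewrite none.
  (* With [q] the index in the ball farthest from [p], every index in the ball lies in [B (p, q)],
     so this single constraint bounds the mass. *)
  have [q xq q_max] := @Order.TotalTheory.arg_maxP _ _ _ p
    (fun i => `|x - a i| <= r) (fun i => `|a p - a i|) xp.
  have dist_2r i : `|x - a i| <= r -> `|a p - a i| <= 2 * r.
    move=> xi; have := ler_distD x (a p) (a i); rewrite (distrC (a p) x).
    by move: xp xi; lra.
  have rad_2r : rad (p, q) <= 2 * r.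
    by rewrite ge_max dist_2r // andbT; lra.
  apply: (@le_trans _ _ (rad (p, q) `^ s)); last first.
    by apply: ge0_ler_powR => //; rewrite nnegrE; move: (rho_rad (p, q)); lra.
  apply: le_trans (w_le (p, q)).
  rewrite [leRHS]big_mkcond [leLHS]big_mkcond /=; apply: ler_sum => i _.
  case: ifPn => xi; last by case: ifP.
  rewrite inE ifT //; apply/andP; split; first by move: rad_2r; lra.
  by rewrite le_max; apply/orP; right; exact: q_max.
- move=> d /mapP[j]; rewrite mem_enum => jD -> /=.
  by have := fintype.subsetP DA j jD; rewrite inE rho_rad => /andP[].
- split; last first.
  + rewrite big_image /= (eq_bigr (fun j => \sum_(q in B j) w q)).
      apply: sum_disjoint_le => // i j iD jD q qi qj; apply: D_disj => //.
      by apply/orP; right; apply/existsP; exists q; rewrite qi.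
    by move=> j /(fintype.subsetP DA); rewrite inE => /andP[_ /eqP].
  + move=> x Fx; have [y ynet xy] := net_dense x Fx.
    have yk : (index y net < k)%N by rewrite index_mem.
    pose p := Ordinal yk; have ap : a p = y by rewrite /a nth_index.
    have [i pi sat_i] := w_sat p.
    have iA : i \in A.
      by rewrite inE sat_i eqxx andbT; move: pi; rewrite inE => /andP[].
    have [j jD /andP[mij rad_ij]] := D_cov i iA.
    exists (a j.1, rad j); first by apply/mapP; exists j; rewrite ?mem_enum.
    rewrite /=; have {}pi : `|a i.1 - y| <= rad i.
      by move: pi; rewrite inE ap => /andP[].
    (* Origin of the factor 4: going from [a j.1] to [x] through [a q], [a i.1] and [y] costs at
       most [rad j + rad i + rad i + rho], each term being at most [rad j]. *)
    have rho_j := rho_rad j.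
    case/predU1P: mij => [ij|/existsP[q]].
      rewrite ij in pi; have := ler_distD y (a j.1) x; rewrite (distrC y x).
      lra.
    rewrite !inE => /andP[/andP[_ iq] /andP[_ jq]].
    have := ler_distD y (a j.1) x; rewrite (distrC y x).
    have := ler_distD (a i.1) (a j.1) y.
    by have := ler_distD (a q) (a j.1) (a i.1); rewrite (distrC (a q)); lra.
Qed.

(** The value of [K] comes from the largest cube: half-width [4 * (2 * delta)] gives diameter
    [K * delta]. *)
Lemma theta_cover_of_cubes (R : realType) (n : nat) (F : set 'rV[R]_n.+1)
    (theta delta s : R) (D : seq ('rV[R]_n.+1 * R))
    (K := 16 * Num.sqrt n.+1%:R : R)
    (htheta : 0 < theta <= 1) (delta0 : 0 < delta) (Kdelta : K * delta <= 1)
    (s0 : 0 <= s)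
    (D_rad : forall d, d \in D -> delta `^ theta^-1 <= d.2 <= 2 * delta)
    (D_cov : forall x, F x -> exists2 d, d \in D & `|d.1 - x| <= 4 * d.2) :
  exists (J : set nat) (U : nat -> set 'rV[R]_n.+1),
    theta_cover theta (K * delta) F J U /\
    (\esum_(i in J) (diam (U i) `^ s) <=
      ((K `^ theta^-1) `^ s * \sum_(d <- D) d.2 `^ s)%:E)%E.
Proof.
have [theta0 theta1] := andP htheta.
pose N : R := Num.sqrt n.+1%:R.
have N1 : 1 <= N by rewrite -[leLHS]sqrtr1; apply: ler_wsqrtr; rewrite ler1n.
have K1 : 1 <= K by rewrite /K -/N; lra.
have itheta1 : 1 <= theta^-1 by rewrite invf_ge1.
have K_le : K <= K `^ theta^-1 by exact: le1r_powR.
(* [side d] is a diameter: that of the cube of half-width [4 * d.2], raised if necessary to the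
   least value allowed. Raising costs only a power of [K], by the lower bound on [d.2]. *)
pose side (d : 'rV[R]_n.+1 * R) :=
  Num.max (8 * N * d.2) ((K * delta) `^ theta^-1).
pose h d := side d / (2 * N).
pose U i := [set y | `|(nth (0, 0) D i).1 - y| <= h (nth (0, 0) D i)].
have side_ge0 d : 0 <= side d by rewrite le_max powR_ge0 orbT.
have h_ge0 d : 0 <= h d by rewrite divr_ge0 //; lra.
have diamU i : diam (U i) = (side (nth (0, 0) D i))%:E.
  rewrite diam_cube // -/N /h; congr (_%:E); field; lra.
have side_le_K d : d \in D -> side d <= K * delta.
  move=> /D_rad/andP[_ d2]; rewrite ge_max; apply/andP; split.
    have -> : K * delta = 8 * N * (2 * delta) by rewrite /K -/N; ring.
    by rewrite ler_wpM2l //; lra.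
  (* [Kdelta] keeps the lower diameter threshold below the upper one. *)
  by rewrite ge1r_powR // Kdelta andbT mulr_gt0 //; lra.
have side_le d : d \in D -> side d <= K `^ theta^-1 * d.2.
  move=> /D_rad/andP[d1 _]; rewrite ge_max; apply/andP; split.
    have := powR_ge0 delta theta^-1.
    by move=> ?; rewrite ler_wpM2r //; move: K_le; rewrite /K -/N; lra.
  rewrite powRM; [|lra|lra].
  by rewrite ler_wpM2l // powR_ge0.
exists `I_(size D), U; split.
  split.
    move=> x /D_cov[d dD xd].
    exists (index d D) => /=; first by rewrite index_mem.
    rewrite /U /= nth_index //; apply: le_trans xd _.
    rewrite /h ler_pdivlMr; last lra.
    by rewrite le_max; apply/orP; left; lra.
  move=> i iD; rewrite diamU !lee_fin side_le_K ?mem_nth // andbT.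
  by rewrite le_max lexx orbT.
rewrite esum_fset; first last.
- by move=> i _; rewrite diamU poweR_EFin lee_fin powR_ge0.
- exact: finite_II.
rewrite -fsbig_ord; under eq_bigr do rewrite diamU poweR_EFin.
rewrite sumEFin lee_fin (big_nth (0, 0)) big_mkord mulr_sumr.
apply: ler_sum => i _.
have iD : nth (0, 0) D i \in D by rewrite mem_nth.
have d2 : 0 <= (nth (0, 0) D i).2.
  by have /andP[/(le_trans (powR_ge0 _ _))] := D_rad _ iD.
rewrite -powRM ?powR_ge0 //.
by apply: ge0_ler_powR; rewrite ?nnegrE // ?side_le // mulr_ge0 ?powR_ge0.
Qed.

(** * Admissible exponents and their infimum *)

Lemma lower_theta_dim_le (R : realType) (n : nat) (F : set 'rV[R]_n)
    (theta s : R) (s0 : 0 <= s) :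
  theta_admissible theta F s -> lower_theta_dim theta F <= s.
Proof. by move=> sF; apply: ge_inf => //; exists 0 => t []. Qed.

(** In dimension 0 all diameters vanish, so a cover with a positive lower diameter bound has no
    members. Hence one admissible exponent makes 0 admissible; if there is none, the infimum is 0 by
    convention. *)
Lemma lower_theta_dim_rV0 (R : realType) (F : set 'rV[R]_0) (theta : R) :
  lower_theta_dim theta F <= 0.
Proof.
have [[t [_ tF]]|A0] :=
    pselect (exists t : R, 0 <= t /\ theta_admissible theta F t); last first.
  by rewrite /lower_theta_dim inf_out // => -[/A0].
apply: lower_theta_dim_le => // eps delta0 eps0 delta00.
have [delta [hdelta [J [U [[covF diamU] _]]]]] := tF _ _ eps0 delta00.
suff J0 : J = set0.
  exists delta; split => //; exists J, U; split; first by [].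
  by rewrite J0 esum_set0 lee_fin ltW.
rewrite -subset0 => i /diamU/andP[].
have -> : diam (U i) = 0%E.
  rewrite /diam; apply/max_idPl/ge_ereal_sup => _ [x [y [_ _ ->]]].
  by rewrite /Defs.edist big_ord0 sqrtr0.
rewrite lee_fin leNgt powR_gt0 //; by case/andP: hdelta.
Qed.

Lemma not_theta_admissible (R : realType) (n : nat) (F : set 'rV[R]_n)
    (theta s : R) :
  ~ theta_admissible theta F s ->
  exists eps delta0 : R, [/\ 0 < eps, 0 < delta0 &
    forall delta J U, 0 < delta <= delta0 -> theta_cover theta delta F J U ->
      (eps%:E < \esum_(i in J) (diam (U i) `^ s))%E].
Proof.
move=> nadm; apply: contrapT => none; apply: nadm => eps delta0 eps0 delta00.
apply: contrapT => nodelta; apply: none; exists eps, delta0; split => //.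
move=> delta J U hdelta cov; rewrite ltNge; apply/negP => small.
by apply: nodelta; exists delta; split => //; exists J, U.
Qed.

Theorem proposition2p3 (R : realType) (n : nat) (F : set 'rV[R]_n)
    (theta s : R) (hF : compact F) (htheta : 0 < theta <= 1)
    (hs : 0 < s < lower_theta_dim theta F) :
  exists c : R, 0 < c /\
    forall delta : R, 0 < delta < 1 ->
      exists mu : probability (borelRn R n) R,
        [/\ supported_on mu F,
            forall (x : 'rV[R]_n) (r : R), delta `^ theta^-1 <= r <= delta ->
              (mu (eball x r) <= (c * r `^ s)%:E)%E
          & finitely_atomic mu].
Proof.
have [s0 s_dim] := andP hs; have [theta0 theta1] := andP htheta.
case: n F hF hs s_dim => [|n] F hF hs s_dim.
  by have := lower_theta_dim_rV0 R F theta; lra.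
have nadm : ~ theta_admissible theta F s.
  by move=> /(lower_theta_dim_le _ _ _ _ _ (ltW s0)); rewrite leNgt s_dim.
(* The empty family covers an empty [F] at no cost, which would make [s] admissible. *)
have [x0 Fx0] : F !=set0.
  apply/set0P/eqP => F0; apply: nadm => eps delta0 eps0 delta00.
  exists delta0; split; first by rewrite delta00 /=.
  exists set0, (fun=> set0); split; last by rewrite esum_set0 lee_fin ltW.
  by split => //; rewrite F0.
have [eps [delta0 [eps0 delta00 big_cover]]] :=
  not_theta_admissible _ _ _ _ _ nadm.
pose K : R := 16 * Num.sqrt n.+1%:R.
have K0 : 0 < K by rewrite mulr_gt0 // sqrtr_gt0.
(* The bound 1 secures [K * delta <= 1] for the cover by cubes. *)
pose delta1 := Num.min delta0 1.
have delta10 : 0 < delta1 by rewrite lt_min delta00 ltr01.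
(* When [K * delta] exceeds [delta1], all radii considered are at least [r0]. *)
pose r0 := (delta1 / K) `^ theta^-1.
have r00 : 0 < r0 by rewrite powR_gt0 // divr_gt0.
pose M := (K `^ theta^-1) `^ s.
have M0 : 0 < M by rewrite !powR_gt0.
have c10 : 0 < 2 `^ s * M / eps by rewrite divr_gt0 // mulr_gt0 // powR_gt0.
have c20 : 0 < (r0 `^ s)^-1 by rewrite invr_gt0 powR_gt0.
(* The first summand serves small [delta], where the weights are used; the second serves large
   [delta], where a point mass suffices. *)
exists (2 `^ s * M / eps + (r0 `^ s)^-1); split; first by rewrite addr_gt0.
move=> delta /andP[delta_gt0 delta_lt1].
have [K_large|K_small] := ltP delta1 (K * delta).
  exists \d_(x0 : borelRn R n.+1); split.
  - by rewrite /supported_on /= diracE memNset // => /(_ Fx0).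
  - move=> x r /andP[rho_r _]; apply: (@le_trans _ _ 1%E).
      by rewrite /= diracE lee_fin lern1 leq_b1.
    have r0r : r0 <= r.
      apply: le_trans rho_r; apply: ge0_ler_powR; rewrite ?nnegrE ?invr_ge0 //.
      - exact: ltW.
      - by rewrite divr_ge0 // ltW.
      - exact: ltW.
      - by rewrite ler_pdivrMr // mulrC ltW.
    rewrite lee_fin mulrDl; apply: ler_wpDl.
      by rewrite mulr_ge0 ?powR_ge0 // ltW.
    rewrite mulrC ler_pdivlMr ?mul1r; last exact: powR_gt0.
    by apply: ge0_ler_powR; rewrite ?nnegrE // ltW // (lt_le_trans r00).
  - exists 1%N, (fun=> 1), (fun=> x0); split => // A _.
    by rewrite big_ord_recl big_ord0 adde0 mul1e.
have [Kdelta0 Kdelta1] : K * delta <= delta0 /\ K * delta <= 1.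
  by move: K_small; rewrite le_min => /andP.
pose rho := delta `^ theta^-1.
have rho0 : 0 < rho by rewrite powR_gt0.
have rho_delta : rho <= delta.
  by rewrite /rho ge1r_powR ?invf_ge1 // delta_gt0 ltW.
have [k [a [w [D [aF w_ge0 w_ball D_rad [D_cov D_mass]]]]]] :=
  frostman_weights _ _ F rho delta s hF rho0 rho_delta (ltW s0).
have [J [U [cov sumU]]] := theta_cover_of_cubes _ _ F theta delta s D htheta
  delta_gt0 Kdelta1 (ltW s0) D_rad D_cov.
pose W := \sum_i w i.
(* The cubes cover [F] at scale [K * delta], at most [delta0], so their sum exceeds [eps]; it is
   also at most [M] times the sum over [D], which [W] dominates. *)
have W_eps : eps < M * W.
  rewrite -lte_fin; apply: (lt_le_trans (big_cover (K * delta) J U _ cov)).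
    by rewrite mulr_gt0.
  by apply: (le_trans sumU); rewrite lee_fin ler_pM2l.
have W0 : 0 < W by rewrite -(pmulr_rgt0 _ M0) (lt_trans eps0).
have [||mu muE] := atomic_probability R _ (borelRn R n.+1) k
    (fun i => w i / W) a.
- by move=> i; rewrite divr_ge0 // ltW.
- by rewrite -mulr_suml divff // gt_eqF.
exists mu; split.
- rewrite /supported_on muE big1 // => i _.
  by rewrite diracE memNset ?mule0 //= => /(_ (aF i)).
- move=> x r hr; have [rho_r _] := andP hr; rewrite muE.
  have r_gt0 : 0 < r by exact: lt_le_trans rho_r.
  apply: (@le_trans _ _ ((2 * r) `^ s / W)%:E); last first.
    rewrite lee_fin powRM //; last exact: ltW.
    rewrite mulrDl; apply: ler_wpDr; first by rewrite mulr_ge0 ?powR_ge0 // ltW.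
    rewrite mulrAC ler_wpM2r ?powR_ge0 // -mulrA ler_wpM2l ?powR_ge0 //.
    by rewrite ler_pdivlMr // mulrC ler_pdivrMr // ltW.
  under eq_bigr do rewrite diracE -EFinM.
  (* The Euclidean ball lies in the sup-norm ball of the same centre and radius. *)
  rewrite sumEFin lee_fin; apply: (@le_trans _ _
      (\sum_(i | `|x - a i| <= r) w i / W)); last first.
    by rewrite -mulr_suml ler_wpM2r ?w_ball // invr_ge0 ltW.
  rewrite [leRHS]big_mkcond; apply: ler_sum => i _.
  have [|xi] := boolP (a i \in eball x r).
    rewrite inE => /(le_trans (normr_le_edist _ _ _ _)) ->.
    by rewrite mulr1.
  by rewrite mulr0; case: ifP; rewrite ?divr_ge0 // ltW.
- exists k, (fun i => w i / W), a; split => // i.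
  by rewrite divr_ge0 // ltW.
Qed.
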